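(* Let $n, N \ge 1$ and $m_1,\dots,m_N \ge 1$ be integers. For $i=1,\dots,N$ let $A_i \in \mathbb{R}^{m_i\times n}$, $y_i\in\mathbb{R}^{m_i}$ and $\sigma_i>0$, and let $\mathcal{L}:\mathbb{R}^n\to\mathbb{R}$ be the joint negative log-likelihood $$\mathcal{L}(x)=\sum_{i=1}^N \frac{1}{2\sigma_i^2}\,\|A_i x-y_i\|_2^2 .$$ Let $\mu_0(x_t)=\mathbb{E}[x_0\mid x_t]$ be the diffusion model's estimation of the data sample $x_0$ from the state $x_t\in\mathbb{R}^n$ at time $t$, assumed to be a differentiable function of $x_t$. Then the likelihood gradient to correct $x_t$ towards the data-consistent manifold is $$\nabla_{x_t}\,\mathcal{L}(\mu_0(x_t))=\sum_{i=1}^N \frac{1}{\sigma_i^2}\,\nabla_{x_t}\,\|A_i\,\mu_0(x_t)-y_i\|_2^2 .$$ In particular, each $A_i$ contributes an independent correction direction, and the combined gradient is their sum.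
   Context: Multi-image observation model: a single unknown high-resolution image $x\in\mathbb{R}^n$ is observed through $N$ independent low-resolution measurements $y_i=A_i x+\epsilon_i$, where $A_i\in\mathbb{R}^{m_i\times n}$ is a known linear operator and $\epsilon_i$ is centered Gaussian noise of standard deviation $\sigma_i$ in each coordinate. The function $\mathcal{L}$ is the joint negative log-likelihood of these measurements (additive constants independent of $x$ are omitted). Diffusion model: for $t\in[0,1]$, the state is $x_t=\alpha_t x_0+\beta_t\epsilon$ with $x_0\in\mathbb{R}^n$ a data sample, $\epsilon\sim\mathcal{N}(\mathbf{0},\mathbf{I})$ and scalar noise-schedule parameters $\alpha_t,\beta_t$. The map $\mu_0$ is the estimate of $\mathbb{E}[x_0\mid x_t]$ computed from $x_t$ by a trained neural network at time $t$; it may be nonlinear. $\nabla_{x_t}$ denotes the gradient with respect to $x_t\in\mathbb{R}^n$, and $\|\cdot\|_2$ is the Euclidean norm. The ''data-consistent manifold'' is informal terminology for the set of images consistent with the measurements, and the ''correction direction'' contributed by $A_i$ is the $i$-th summand of the gradient formula.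
   Formalization: The displayed gradient formula is off by a factor 2 for the given likelihood; the coefficient 1/σ_i² in front of each gradient is corrected to 1/(2σ_i²), matching the definition of L. *)

(* Defs.v *)
From HB Require Import structures.
From mathcomp Require Import all_boot all_order all_algebra.
From mathcomp Require Import all_classical all_reals all_analysis.
Set Implicit Arguments.
Unset Strict Implicit.
Unset Printing Implicit Defensive.
Import Order.TTheory GRing.Theory Num.Theory.
Import numFieldNormedType.Exports.
Local Open Scope ring_scope.

(* The library's norm on matrices is the sup norm, hence this definition. *)
Definition norm2 (R : realType) (k : nat) (v : 'cV[R]_k) : R :=
  Num.sqrt (\sum_(j < k) v j 0 ^+ 2).

(* This is the usual gradient at points where [f] is differentiable; elsewhere
   'D_v f is the library's totalised directional derivative and the value is
   not meaningful. *)
Definition gradient (R : realType) (n : nat) (f : 'cV[R]_n -> R)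
    (x : 'cV[R]_n) : 'cV[R]_n :=
  \col_(j < n) 'D_(delta_mx j 0) f x.

(* Joint negative log-likelihood of the observations y_i = A_i x + eps_i with
   independent eps_i ~ N(0, sigma_i^2 I), up to an additive constant
   independent of x. *)
Definition neg_log_likelihood (R : realType) (n N : nat) (m : 'I_N -> nat)
    (A : forall i : 'I_N, 'M[R]_(m i, n)) (y : forall i : 'I_N, 'cV[R]_(m i))
    (sigma : 'I_N -> R) (x : 'cV[R]_n) : R :=
  \sum_(i < N) (2 * sigma i ^+ 2)^-1 * norm2 (A i *m x - y i) ^+ 2.

(* Main.v *)
Require Import Defs.
From HB Require Import structures.
From mathcomp Require Import all_boot all_order all_algebra.
From mathcomp Require Import all_classical all_reals all_analysis.
Import Order.TTheory GRing.Theory Num.Theory.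
Import numFieldNormedType.Exports.
Local Open Scope ring_scope.

(** The composed likelihood is a finite linear combination, with constant weights, of the squared
    residuals, so the formula is linearity of the gradient ([gradient_lincomb]). What needs checking
    is that each squared residual is differentiable ([differentiable_sqr_norm2_affine]), so that the
    gradients are genuine. The chain rule through [mu0 t] is never expanded, hence the weights stay
    those of the likelihood, 1/(2 sigma_i^2); with 1/sigma_i^2 the right-hand side would be
    doubled. *)

Lemma sqr_norm2 (R : realType) (k : nat) (v : 'cV[R]_k) :
  norm2 v ^+ 2 = \sum_(j < k) v j 0 ^+ 2.
Proof. by rewrite sqr_sqrtr // sumr_ge0 // => j _; exact: sqr_ge0. Qed.

(** Squaring removes the square root, which is not differentiable at 0; what remains is a polynomial
    in the coordinates of [f]. *)
Lemma differentiable_sqr_norm2_affine (R : realType) (V : normedModType R)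
    (k n : nat) (A : 'M[R]_(k, n)) (y : 'cV[R]_k) (f : V -> 'cV[R]_n) (x : V) :
  differentiable f x ->
  differentiable (fun z => norm2 (A *m f z - y) ^+ 2) x.
Proof.
move=> df.
have coord l : differentiable (fun z => f z l 0 : R) x.
  exact: (differentiable_comp df (differentiable_coord _ l 0)).
(* The polynomial is written with operations on functions, the form to which the rules for sums,
   powers and scalings apply. *)
have -> : (fun z => norm2 (A *m f z - y) ^+ 2) = \sum_(j < k)
    (\sum_(l < n) A j l *: (fun z => f z l 0 : R) - cst (y j 0)) ^+ 2.
  apply/funext => z; rewrite sqr_norm2 fct_sumE; apply: eq_bigr => j _.
  rewrite exprfctE !mxE; congr ((_ - _) ^+ 2).
  by rewrite fct_sumE; apply: eq_bigr.
apply: differentiable_sum => j; apply: differentiableX.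
apply: differentiableB; last exact: differentiable_cst.
by apply: differentiable_sum => l; apply: differentiableZ.
Qed.

(** Each coordinate is a directional derivative, which is linear on functions derivable in that
    direction; differentiability supplies this for every basis vector. *)
Lemma gradient_lincomb (R : realType) (n N : nat) (c : 'I_N -> R)
    (f : 'I_N -> 'cV[R]_n -> R) (x : 'cV[R]_n) :
  (forall i, differentiable (f i) x) ->
  gradient (\sum_(i < N) c i *: f i) x = \sum_(i < N) c i *: gradient (f i) x.
Proof.
move=> df; apply/colP => j; rewrite mxE summxE derive_sum; last first.
  by move=> i; apply/diff_derivable/differentiableZ.
apply: eq_bigr => i _; rewrite !mxE.
exact/deriveZ/diff_derivable.
Qed.

Theorem proposition1 (R : realType) (n N : nat) (m : 'I_N -> nat)
    (hn : (1 <= n)%N) (hN : (1 <= N)%N) (hm : forall i : 'I_N, (1 <= m i)%N)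
    (A : forall i : 'I_N, 'M[R]_(m i, n)) (y : forall i : 'I_N, 'cV[R]_(m i))
    (sigma : 'I_N -> R) (hsigma : forall i : 'I_N, 0 < sigma i)
    (mu0 : R -> 'cV[R]_n -> 'cV[R]_n) (t : R) (ht : 0 <= t <= 1)
    (hmu0 : forall x : 'cV[R]_n, differentiable (mu0 t) x)
    (xt : 'cV[R]_n) :
  [/\ differentiable
        (fun x : 'cV[R]_n => neg_log_likelihood A y sigma (mu0 t x)) xt,
      forall i : 'I_N,
        differentiable
          (fun x : 'cV[R]_n => norm2 (A i *m mu0 t x - y i) ^+ 2) xt
    & gradient (fun x : 'cV[R]_n => neg_log_likelihood A y sigma (mu0 t x)) xt
      = \sum_(i < N) (2 * sigma i ^+ 2)^-1 *:
          gradient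
            (fun x : 'cV[R]_n => norm2 (A i *m mu0 t x - y i) ^+ 2) xt].
Proof.
have dterm i : differentiable (fun x => norm2 (A i *m mu0 t x - y i) ^+ 2) xt.
  exact: differentiable_sqr_norm2_affine.
(* A pointwise sum becomes a linear combination of functions, as [gradient_lincomb] expects. *)
have -> : (fun x => neg_log_likelihood A y sigma (mu0 t x)) =
    \sum_(i < N) (2 * sigma i ^+ 2)^-1 *:
      (fun x => norm2 (A i *m mu0 t x - y i) ^+ 2).
  by apply/funext => x; rewrite fct_sumE.
split=> //; last exact: gradient_lincomb.
by apply: differentiable_sum => i; apply: differentiableZ.
Qed.
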